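(* Let $c\geq 2$ and let $\Phi:\mathscr{C}(\mathbb{E}^{c})\to\mathscr{C}(\mathbb{E}^{d})$ be a non-trivial lattice homomorphism. Then for every $C\in\mathscr{C}(\mathbb{E}^{c})$, $$\dim(C)\leq c-2\ \Longrightarrow\ \dim(\Phi(C))\leq\dim(C)+d-c.$$
   Context: $\mathbb{E}^{d}$ denotes $d$-dimensional Euclidean space. $\mathscr{C}(\mathbb{E}^{d})$ is the set of all compact convex subsets of $\mathbb{E}^{d}$, including the empty set; it is a lattice with $C\wedge D=C\cap D$ and $C\vee D=\operatorname{conv}(C\cup D)$. A lattice homomorphism preserves both operations $\wedge$ and $\vee$. It is called trivial if it maps all elements (including $\emptyset$) to one and the same set, and non-trivial otherwise. The dimension $\dim(C)$ of a convex set is the dimension of its affine hull, with $\dim(\emptyset)=-1$. *)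

(* Defs.v *)
From HB Require Import structures.
From mathcomp Require Import all_boot all_order all_algebra.
From mathcomp Require Import all_classical all_reals all_analysis.
From mathcomp Require Import ring lra.

Set Implicit Arguments.
Unset Strict Implicit.
Unset Printing Implicit Defensive.

Import Order.TTheory GRing.Theory Num.Theory.
Import numFieldNormedType.Exports.

Local Open Scope classical_set_scope.
Local Open Scope ring_scope.

(* Euclidean space of dimension n is ['rV[R]_n]; the norm that the library puts
   on it is the sup norm, which induces the Euclidean topology. *)

Section convex_hull.
Context {R : realType} {n : nat}.
Implicit Types A B C D : set 'rV[R]_n.

Definition conv_hull A : set 'rV[R]_n := smallest (@convex_set R 'rV[R]_n) A.

Lemma convex_setP A : @convex_set R 'rV[R]_n A <->
  forall x y t, A x -> A y -> 0 <= t <= 1 -> A (t *: x + (1 - t) *: y).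
Proof.
split=> [cA x y t Ax Ay t01|cA x y t /set_mem Ax /set_mem Ay].
  have [t0 t1] := andP t01.
  have := cA x y (Itv01 t0 t1); rewrite !inE; exact.
by apply/mem_set; apply: cA => //; apply/andP; split.
Qed.

Lemma convex_conv_hull A : @convex_set R 'rV[R]_n (conv_hull A).
Proof.
apply/convex_setP => x y t hx hy t01 B [cB AB].
by apply: (convex_setP B).1 => //; [apply: hx|apply: hy].
Qed.

Lemma convex_setI A B : @convex_set R 'rV[R]_n A ->
  @convex_set R 'rV[R]_n B -> @convex_set R 'rV[R]_n (A `&` B).
Proof.
move=> /convex_setP cA /convex_setP cB; apply/convex_setP => x y t [Ax Bx] [Ay By] t01.
by split; [apply: cA|apply: cB].
Qed.

Lemma convex_comb A x y u v : @convex_set R 'rV[R]_n A -> A x -> A y ->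
  0 <= u -> 0 <= v -> exists2 z, A z & u *: x + v *: y = (u + v) *: z.
Proof.
move=> /convex_setP cA Ax Ay u0 v0.
have [uv0|uv0] := eqVneq (u + v) 0.
  have [-> ->] : u = 0 /\ v = 0 by split; lra.
  by exists x => //; rewrite addr0 !scale0r addr0.
have uvp : 0 < u + v by rewrite lt_neqAle eq_sym uv0 addr_ge0.
exists ((u / (u + v)) *: x + (1 - u / (u + v)) *: y).
  apply: cA => //; apply/andP; split; first by rewrite divr_ge0 // ltW.
  by rewrite ler_pdivrMr // mul1r lerDl.
rewrite scalerDr !scalerA; by congr (_ *: _ + _ *: _); field.
Qed.

Definition segments C D : set 'rV[R]_n :=
  (fun p : R * ('rV[R]_n * 'rV[R]_n) => p.1 *: p.2.1 + (1 - p.1) *: p.2.2) @`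
    (`[0, 1] `*` (C `*` D)).

Lemma conv_hullUE C D : @convex_set R 'rV[R]_n C -> @convex_set R 'rV[R]_n D ->
  C !=set0 -> D !=set0 -> conv_hull (C `|` D) = segments C D.
Proof.
move=> cC cD [c0 Cc0] [d0 Dd0]; apply/seteqP; split; last first.
  move=> _ [[t [x y]] /= [] t01 [Cx Dy] <-] B [cB CDB].
  apply: (convex_setP B).1 => //; [by apply: CDB; left|by apply: CDB; right].
apply: smallest_sub; last first.
  move=> x [Cx|Dx].
    exists (1, (x, d0)); rewrite /= ?in_itv /= ?ler01 ?lexx //.
    by rewrite subrr scale0r addr0 scale1r.
  exists (0, (c0, x)); rewrite /= ?in_itv /= ?ler01 ?lexx //.
  by rewrite subr0 scale0r add0r scale1r.
apply/convex_setP => p q l [[t [a b]] /= [] t01 [Ca Db] <-].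
move=> [[s [a' b']] /= [] s01 [Ca' Db'] <-] /andP[l0 l1] {p q}.
move: t01 s01; rewrite !in_itv /= => /andP[t0 t1] /andP[s0 s1].
have m0 : 0 <= 1 - l by rewrite subr_ge0.
have mt0 : 0 <= 1 - t by rewrite subr_ge0.
have ms0 : 0 <= 1 - s by rewrite subr_ge0.
have [x Cx ex] := convex_comb cC Ca Ca' (mulr_ge0 l0 t0) (mulr_ge0 m0 s0).
have [y Dy ey] := convex_comb cD Db Db' (mulr_ge0 l0 mt0) (mulr_ge0 m0 ms0).
exists (l * t + (1 - l) * s, (x, y)) => /=.
  split => //=; rewrite in_itv /= addr_ge0 ?mulr_ge0 //=.
  by have := mulr_ge0 l0 mt0; have := mulr_ge0 m0 ms0; lra.
rewrite -ex (_ : 1 - (l * t + (1 - l) * s) =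
  l * (1 - t) + (1 - l) * (1 - s)); last by ring.
by rewrite -ey !scalerDr !scalerA addrACA.
Qed.

Lemma compact_conv_hullU C D : compact C -> @convex_set R 'rV[R]_n C ->
  compact D -> @convex_set R 'rV[R]_n D -> compact (conv_hull (C `|` D)).
Proof.
move=> kC cC kD cD.
have [->|C0] := eqVneq C set0; first by rewrite set0U [conv_hull _]smallest_id.
have [->|D0] := eqVneq D set0; first by rewrite setU0 [conv_hull _]smallest_id.
rewrite conv_hullUE //; [|exact/set0P|exact/set0P].
apply: continuous_compact; last first.
  by apply: compact_setX; [exact: segment_compact|exact: compact_setX].
apply: continuous_subspaceT => p.
apply: cvgD; apply: cvgZ.
- exact: cvg_fst.
- exact: (cvg_comp _ _ cvg_snd cvg_fst).
- by apply: cvgB; [exact: cvg_cst|exact: cvg_fst].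
- exact: (cvg_comp _ _ cvg_snd cvg_snd).
Qed.

End convex_hull.

Record compactConvex (R : realType) (n : nat) := CompactConvex {
  cc_set :> set 'rV[R]_n;
  cc_compact : compact cc_set;
  cc_convex : @convex_set R 'rV[R]_n cc_set }.

Arguments cc_compact {R n}.
Arguments cc_convex {R n}.

HB.instance Definition _ (R : realType) n := gen_eqMixin (compactConvex R n).
HB.instance Definition _ (R : realType) n := gen_choiceMixin (compactConvex R n).

Fact cc_display : Order.disp_t. Proof. exact: Order.Disp tt tt. Qed.

Section lattice.
Context {R : realType} {n : nat}.
Implicit Types C D : compactConvex R n.

Lemma cc_inj : injective (@cc_set R n).
Proof.
move=> [A kA cA] [B kB cB] /= AB; move: kA cA kB cB; rewrite AB => *.
by congr CompactConvex; exact: Prop_irrelevance.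
Qed.

Lemma compact_ccI C D : compact ((C : set _) `&` D).
Proof.
apply: compact_closedI; first exact: cc_compact.
apply: compact_closed; [exact: norm_hausdorff|exact: cc_compact].
Qed.

Definition cc_meet C D : compactConvex R n :=
  CompactConvex (@compact_ccI C D)
    (convex_setI (cc_convex C) (cc_convex D)).

Definition cc_join C D : compactConvex R n :=
  CompactConvex
    (compact_conv_hullU (cc_compact C) (cc_convex C) (cc_compact D) (cc_convex D))
    (@convex_conv_hull R n ((C : set _) `|` D)).

Definition cc_le C D := `[< (C : set _) `<=` D >].

Lemma cc_le_refl : reflexive cc_le.
Proof. by move=> C; apply/asboolP. Qed.

Lemma cc_le_anti : antisymmetric cc_le.
Proof.
move=> C D /andP[/asboolP CD /asboolP DC].
by apply: cc_inj; apply/seteqP; split.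
Qed.

Lemma cc_le_trans : transitive cc_le.
Proof.
by move=> D C E /asboolP CD /asboolP DE; apply/asboolP; exact: subset_trans DE.
Qed.

Lemma cc_meetP C D E : cc_le C (cc_meet D E) = cc_le C D && cc_le C E.
Proof.
apply/asboolP/andP => [CDE|[/asboolP CD /asboolP CE]].
  by split; apply/asboolP => x /CDE[].
by move=> x Cx; split; [exact: CD|exact: CE].
Qed.

Lemma cc_joinP C D E : cc_le (cc_join C D) E = cc_le C E && cc_le D E.
Proof.
apply/asboolP/andP => [CDE|[/asboolP CE /asboolP DE]].
  split; apply/asboolP => x hx; apply: CDE; apply: sub_gen_smallest.
    by left.
  by right.
apply: smallest_sub; first exact: cc_convex.
by move=> x [/CE|/DE].
Qed.

End lattice.

HB.instance Definition _ (R : realType) n :=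
  Order.Le_isPOrder.Build cc_display (compactConvex R n)
    cc_le_refl cc_le_anti cc_le_trans.

HB.instance Definition _ (R : realType) n :=
  Order.POrder_MeetJoin_isLattice.Build cc_display (compactConvex R n)
    cc_meetP cc_joinP.

Lemma cc_leE (R : realType) n (C D : compactConvex R n) :
  (C <= D)%O <-> (C : set _) `<=` D.
Proof. by split => [/asboolP|h]; last apply/asboolP. Qed.

Lemma cc_meetE (R : realType) n (C D : compactConvex R n) :
  (C `&` D)%O = (C : set _) `&` D :> set _.
Proof. by []. Qed.

Lemma cc_joinE (R : realType) n (C D : compactConvex R n) :
  (C `|` D)%O = conv_hull ((C : set _) `|` D) :> set _.
Proof. by []. Qed.

Definition trivial_morphism (R : realType) (c d : nat)
    (Phi : {lmorphism compactConvex R c -> compactConvex R d}) : Prop :=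
  exists K : compactConvex R d, forall C : compactConvex R c, Phi C = K.

Section dimension.
Context {R : realType} {n : nat}.
Implicit Types A B : set 'rV[R]_n.

Definition affine_set A : Prop :=
  forall x y (t : R), A x -> A y -> A (t *: x + (1 - t) *: y).

Definition affine_hull A : set 'rV[R]_n := smallest affine_set A.

(* The linear subspace U such that A = x + U for some x; it exists and is unique
   when A is a nonempty affine set. *)
Definition direction A : {vspace 'rV[R]_n} :=
  xget 0%VS [set U : {vspace 'rV[R]_n} |
    exists x, A = [set x + u | u in [set u | u \in U]]].

Definition affine_dim A : int :=
  if A == set0 then -1 else (\dim (direction A))%:Z.

Definition set_dim A : int := affine_dim (affine_hull A).

Lemma affine_set_affine_hull A : affine_set (affine_hull A).
Proof.
move=> x y t hx hy B [aB AB].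
by apply: (aB) => //; [apply: hx|apply: hy].
Qed.

Lemma linear_set_vspace (S : set 'rV[R]_n) : S 0 ->
  (forall (a : R) u v, S u -> S v -> S (a *: u + v)) ->
  exists U : {vspace 'rV[R]_n}, S = [set u | u \in U].
Proof.
move=> S0 SL.
pose P k := `[< exists2 U : {vspace 'rV[R]_n},
  (forall u, u \in U -> S u) & \dim U = k >].
have P0 : exists k, P k.
  exists 0; apply/asboolP; exists 0%VS; last by rewrite dimv0.
  by move=> u; rewrite memv0 => /eqP->.
have Pb k : P k -> (k <= \dim (fullv : {vspace 'rV[R]_n}))%N.
  by move=> /asboolP[U _ <-]; exact: dimvS (subvf _).
case: (ex_maxnP P0 Pb) => k /asboolP[U US Uk] kmax; exists U.
apply/seteqP; split => v /=; last exact: US.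
move=> Sv; apply: contrapT => /negP vU.
have : P (\dim (U + <[v]>)%VS).
  apply/asboolP; exists (U + <[v]>)%VS => // _ /memv_addP[u uU [_ /vlineP[a ->] ->]].
  by rewrite addrC; apply: SL => //; exact: US.
move=> /kmax; apply/negP; rewrite -ltnNge -Uk.
rewrite ltn_neqAle dimvS ?addvSl // andbT.
apply: contra vU => /eqP e.
have : (U == U + <[v]>)%VS by rewrite eqEdim addvSl e leqnn.
by move=> /eqP ->; apply: (subvP (addvSr U <[v]>%VS)); exact: memv_line.
Qed.

Lemma directionP A x : affine_set A -> A x ->
  A = [set x + u | u in [set u | u \in direction A]].
Proof.
move=> aA Ax.
have tr (a b c : 'rV[R]_n) : A a -> A b -> A c -> A (a + b - c).
  move=> Aa Ab Ac; have := aA _ _ 2 (aA _ _ 2^-1 Aa Ab) Ac; congr (A _).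
  by apply/rowP => i; rewrite !mxE; field.
have [U SU] : exists U : {vspace 'rV[R]_n}, [set u | A (x + u)] = [set u | u \in U].
  apply: linear_set_vspace => /=; first by rewrite addr0.
  move=> a u v Axu Axv.
  have := tr _ _ _ (aA _ _ a Axu Ax) Axv Ax; congr (A _).
  by apply/rowP => i; rewrite !mxE; ring.
have xg := @xgetPex _ 0%VS [set U : {vspace 'rV[R]_n} |
    exists x, A = [set x + u | u in [set u | u \in U]]].
have [|y Ay] := xg.
  exists U, x; apply/seteqP; split => [z Az|_ [u + <-]].
    by exists (z - x); [rewrite -SU /= addrC subrK|rewrite addrC subrK].
  by rewrite -SU.
rewrite -/(direction A) in Ay.
move: (Ax); rewrite [in X in X -> _]Ay => -[w wU xE].
rewrite [LHS]Ay; apply/seteqP; split => _ [u uU <-] /=.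
  exists (u - w); first by rewrite /= rpredB.
  by rewrite -xE -addrA (addrC u) addNKr.
by exists (w + u); [rewrite /= rpredD|rewrite -xE addrA].
Qed.

End dimension.

(* Main.v *)
Require Import Defs.
From mathcomp Require Import all_boot all_order all_algebra.
From mathcomp Require Import all_classical all_reals all_analysis.
From mathcomp Require Import ring lra zify.

Set Implicit Arguments.
Unset Strict Implicit.
Unset Printing Implicit Defensive.

Import Order.TTheory GRing.Theory Num.Theory.
Import numFieldNormedType.Exports.

Local Open Scope classical_set_scope.
Local Open Scope ring_scope.

(* A non-trivial homomorphism Phi is strictly increasing: if it identified two
   sets, it would identify some point with the empty set, then (taking midpoints)
   every point, hence every compact convex set.

   If dim C <= c - 2, there are uncountably many points x_t such that the sets
   C v x_t meet pairwise in C only. Their images are strictly larger than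
   K := Phi C and meet pairwise in K. Let H be the affine hull of K and v any
   vector. If all the images were contained in H + R v, each of them would
   contain, outside K, a point with rational coordinates in a fixed frame,
   which is impossible since these points are countably many. With v = 0 this
   gives dim Phi (C v x_t) > dim Phi C for some t; with arbitrary v it gives
   dim Phi C <= d - 2. Iterating C |-> C v x_t until dimension c - 2 is reached
   yields the theorem. *)

(** * Dimension through free families and flats *)

Section affine_dimension.
Context {R : realType} {n : nat}.
Implicit Types (A B : set 'rV[R]_n) (V W : {vspace 'rV[R]_n}).

Definition flat (p : 'rV[R]_n) V : set 'rV[R]_n := [set x | x - p \in V].

Lemma affine_flat p V : affine_set (flat p V).
Proof.
move=> x y t xV yV; rewrite /flat /=.
have -> : t *: x + (1 - t) *: y - p = t *: (x - p) + (1 - t) *: (y - p).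
  by apply/rowP => i; rewrite !mxE; ring.
by rewrite memvD // memvZ.
Qed.

(** A maximal free family of vectors leading from [p] to points of [A] will do: maximality puts [A]
    in the flat. These points lie in [A] itself, not just in its affine hull, so a convex [A]
    contains a full-dimensional simplex at [p]. *)
Lemma set_dim_frame A p : A p -> exists X : seq 'rV[R]_n,
  [/\ free X, (forall x, x \in X -> A (p + x)), A `<=` flat p <<X>>%VS &
      set_dim A = (size X)%:Z].
Proof.
move=> Ap.
pose P k := `[< exists X : seq 'rV[R]_n,
  [/\ free X, (forall x, x \in X -> A (p + x)) & size X = k] >].
have P0 : exists k, P k.
  by exists 0; apply/asboolP; exists [::]; split => //; rewrite nil_free.
have Pb k : P k -> (k <= \dim (fullv : {vspace 'rV[R]_n}))%N.
  move=> /asboolP[X [fX _ <-]]; rewrite -(eqP fX); exact: dimvS (subvf _).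
case: (ex_maxnP P0 Pb) => k /asboolP[X [fX AX sX]] kmax.
have AV : A `<=` flat p <<X>>%VS.
  move=> z Az; rewrite /flat /=; apply: contrapT => /negP zX.
  have : P k.+1.
    apply/asboolP; exists (z - p :: X); split; rewrite /= ?sX //.
      by rewrite free_cons zX.
    by move=> x; rewrite inE => /orP[/eqP->|/AX //]; rewrite addrC subrK.
  by move=> /kmax; rewrite ltnn.
exists X; split => //; rewrite /set_dim /affine_dim.
have AH : A `<=` affine_hull A by apply: sub_gen_smallest.
have Hp := AH _ Ap.
rewrite ifF; last by apply/negbTE/set0P; exists p.
have HU := directionP (@affine_set_affine_hull _ _ A) Hp.
have HV : affine_hull A `<=` flat p <<X>>%VS.
  by apply: smallest_sub => //; exact: affine_flat.
rewrite -(eqP fX); congr (\dim _)%:Z; apply/eqP; rewrite eqEsubv.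
apply/andP; split.
  apply/subvP => u uU; have : affine_hull A (p + u) by rewrite HU; exists u.
  by move=> /HV; rewrite /flat /= addrC addKr.
apply/span_subvP => x /AX /AH HAx.
have [u /= uU /addrI <- //] : [set p + u | u in [set u | u \in direction (affine_hull A)]] (p + x).
by rewrite -HU.
Qed.

Lemma set_dim0 : set_dim (@set0 'rV[R]_n) = -1.
Proof.
suff H0 : affine_hull (@set0 'rV[R]_n) = set0 by rewrite /set_dim H0 /affine_dim eqxx.
by rewrite -subset0; apply: smallest_sub => // x y t [].
Qed.

Lemma set_dim_flat A p V : A `<=` flat p V -> A !=set0 -> set_dim A <= (\dim V)%:Z.
Proof.
move=> AV [q Aq]; have [X [fX AX _ ->]] := set_dim_frame Aq.
rewrite -(eqP fX) lez_nat; apply/dimvS/span_subvP => x /AX /AV.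
rewrite /flat /= => qxV; have := memvB qxV (AV _ Aq).
by rewrite (_ : _ - _ - _ = x) //; apply/rowP => i; rewrite !mxE; ring.
Qed.

Lemma set_dim_ge0 A : A !=set0 -> 0 <= set_dim A.
Proof. by move=> [p Ap]; have [X [_ _ _ ->]] := set_dim_frame Ap. Qed.

End affine_dimension.

(** * Points with rational coordinates outside a convex set *)

Lemma convex_span_comb (R : realType) n m (A : set 'rV[R]_n) p
    (X : 'I_m -> 'rV[R]_n) (l : 'I_m -> R) :
  @convex_set R 'rV[R]_n A -> A p -> (forall i, A (p + X i)) ->
  (forall i, 0 <= l i) -> \sum_i l i <= 1 -> A (p + \sum_i l i *: X i).
Proof.
move=> cA Ap AX l0 l1.
have [s0 [z Az sz]] : 0 <= \sum_i l i /\
    exists2 z, A z & \sum_i l i *: (p + X i) = (\sum_i l i) *: z.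
  (* Carrying the total weight along as a factor keeps the induction free of divisions, even when
     all weights vanish. *)
  apply: (big_ind2 (fun (v : 'rV[R]_n) (s : R) =>
    0 <= s /\ exists2 z, A z & v = s *: z)).
  - by split=> //; exists p => //; rewrite scale0r.
  - move=> _ s _ t [s0 [x Ax ->]] [t0 [y Ay ->]]; split; first exact: addr_ge0.
    by have [z Az ->] := convex_comb cA Ax Ay s0 t0; exists z.
  - by move=> i _; split=> //; exists (p + X i).
have s1 : 0 <= 1 - \sum_i l i by rewrite subr_ge0.
have [y Ay ey] := convex_comb cA Az Ap s0 s1.
suff -> : p + \sum_i l i *: X i = y by [].
rewrite addrCA subrr addr0 scale1r -sz in ey; rewrite -ey scalerBl scale1r.
under [in RHS]eq_bigr do rewrite scalerDr.
by rewrite big_split /= -scaler_suml [RHS]addrC addrA subrK.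
Qed.

(** Each [q i] is taken from an interval of length [e / (m + 1)] above [(1 - e) * z i], so every
    weight is at most [1 / (m + 1)] and their sum at most 1. *)
Lemma rational_simplex_point (R : realType) m (z : 'I_m -> R) (e : R) : 0 < e ->
  exists (q : {ffun 'I_m -> rat}) (l : 'I_m -> R), [/\ forall i, 0 <= l i,
    \sum_i l i <= 1 & forall i, (1 - e) * z i + e * l i = ratr (q i)].
Proof.
move=> e0.
have m0 : 0 < m.+1%:R^-1 :> R by rewrite invr_gt0 ltr0n.
have /fin_all_exists[q hq] i : exists q : rat,
    ratr q \in `](1 - e) * z i, (1 - e) * z i + e * m.+1%:R^-1[.
  by apply: rat_in_itvoo; rewrite ltrDl mulr_gt0.
exists (finfun q), (fun i => (ratr (q i) - (1 - e) * z i) / e); split.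
- move=> i; rewrite divr_ge0 ?(ltW e0) // subr_ge0.
  by have := hq i; rewrite in_itv /= => /andP[/ltW].
- apply: (@le_trans _ _ (\sum_(i < m) m.+1%:R^-1)).
    apply: ler_sum => i _; rewrite ler_pdivrMr // lerBlDl [_ * e]mulrC.
    by have := hq i; rewrite in_itv /= => /andP[_ /ltW].
  rewrite sumr_const card_ord -[X in X <= _]mulr_natl ler_pdivrMr ?ltr0n //.
  by rewrite mul1r ler_nat.
- by move=> i; rewrite ffunE; field; rewrite gt_eqF.
Qed.

Section rational_points.
Context {R : realType} {n : nat}.
Context (K : compactConvex R n) (p v : 'rV[R]_n) (X : seq 'rV[R]_n).

Definition rational_point (w : {ffun 'I_(size X) -> rat} * rat) : 'rV[R]_n :=
  p + (\sum_i ratr (w.1 i) *: X`_i + ratr w.2 *: v).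

Context (Kp : (K : set _) p) (KX : forall x, x \in X -> (K : set _) (p + x)).
Context (KV : (K : set _) `<=` flat p <<X>>%VS).

(* The simplex spanned by [p] and the [p + x], [x] in [X], lies in [K]; its
   contraction towards a given point contains a point with rational coordinates
   along [X]. *)
Lemma contraction_rational_point (z : 'I_(size X) -> R) (e : R) : 0 < e <= 1 ->
  exists q : {ffun 'I_(size X) -> rat}, exists2 y, (K : set _) y &
   forall s, (1 - e) *: (p + (\sum_i z i *: X`_i + s *: v)) + e *: y =
    p + (\sum_i ratr (q i) *: X`_i + ((1 - e) * s) *: v).
Proof.
move=> /andP[e0 e1]; have [q [l [l0 l1 lq]]] := rational_simplex_point z e0.
exists q; exists (p + \sum_i l i *: X`_i).
  apply: convex_span_comb => //; first exact: cc_convex.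
  by move=> i; apply: KX; rewrite mem_nth.
move=> s; under [in RHS]eq_bigr do rewrite -lq scalerDl -!scalerA.
rewrite big_split /= -!scaler_sumr !scalerDr scalerA.
by apply/rowP => i; rewrite !mxE; ring.
Qed.

(** A point [z] of [D] outside [K] is moved towards a point of [K]. If [z] lies in the affine hull
    of [K], a small move stays outside the closed set [K]; otherwise the move makes the coordinate
    along [v] rational and nonzero, which keeps the point off that hull. *)
Lemma rational_point_outside (D : compactConvex R n) :
  (K <= D)%O -> ~ (D <= K)%O -> (D : set _) `<=` flat p (<<X>> + <[v]>)%VS ->
  exists w, (D : set _) (rational_point w) /\ ~ (K : set _) (rational_point w).
Proof.
move=> /cc_leE KD DK DV.
have [z Dz Kz] : exists2 z, (D : set _) z & ~ (K : set _) z.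
  apply: contrapT => h; apply: DK; apply/cc_leE => z Dz.
  by apply: contrapT => Kz; apply: h; exists z.
have cD := (convex_setP _).1 (cc_convex D).
have spanE u : u \in <<X>>%VS -> exists a : 'I_(size X) -> R, u = \sum_i a i *: X`_i.
  by move=> /(@coord_span _ _ _ (in_tuple X)) uE; eexists; exact: uE.
have [zV|zV] := boolP (z - p \in <<X>>%VS).
  have [a za] := spanE _ zV.
  have zE : z = p + (\sum_i a i *: X`_i + 0 *: v).
    by rewrite scale0r addr0 -za addrC subrK.
  have cK : closed (K : set _).
    by apply: compact_closed; [exact: norm_hausdorff|exact: cc_compact].
  have [e /= e0 zK] : nbhs_ball z (~` (K : set _)).
    by apply/nbhs_ballP/open_nbhs_nbhs; split => //; exact: closed_openC.
  have [M [M0 KM]] : exists M : R, 0 <= M /\ forall y, (K : set _) y -> `|z - y| <= M.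
    have [M [_ hM]] := compact_bounded (cc_compact K).
    have {}hM y : (K : set _) y -> `|y| <= `|M| + 1.
      by apply: hM; rewrite (le_lt_trans (ler_norm M)) // ltrDl.
    exists (`|z| + (`|M| + 1)); split; first by rewrite !addr_ge0.
    by move=> y /hM hy; rewrite (le_trans (ler_normB _ _)) // lerD2l.
  (* With the factor [e / (e + M)], the point [z] moves by at most [e * M / (e + M)], which is less
     than [e]. *)
  have eM : 0 < e + M by rewrite ltr_pwDl.
  have d01 : 0 < e / (e + M) <= 1.
    by rewrite divr_gt0 //= ler_pdivrMr // mul1r lerDl.
  have [q [y Ky yE]] := contraction_rational_point a d01.
  have := yE 0; rewrite -zE mulr0 => {}yE.
  exists (q, 0); rewrite /rational_point /= raddf0 -yE; split.
    rewrite -[X in _ + X *: y](subKr 1); apply: cD => //; first exact: KD.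
    by have [/ltW d0 d1] := andP d01; rewrite subr_ge0 d1 gerBl.
  apply: zK; rewrite -ball_normE /ball_ /=.
  have -> : z - ((1 - e / (e + M)) *: z + (e / (e + M)) *: y) = (e / (e + M)) *: (z - y).
    by apply/rowP => i; rewrite !mxE; ring.
  have [/ltW d0 _] := andP d01.
  rewrite normrZ ger0_norm //; apply: le_lt_trans (_ : e / (e + M) * M < e).
    by rewrite ler_wpM2l // KM.
  by rewrite mulrAC ltr_pdivrMr // ltr_pM2l // ltrDr.
have /memv_addP[u uX [_ /vlineP[b ->] zE]] := DV _ Dz.
have [a ua] := spanE _ uX.
have b0 : b != 0.
  by apply: contra zV => /eqP b0; rewrite zE b0 scale0r addr0.
have vX : v \notin <<X>>%VS.
  by apply: contra zV => vX; rewrite zE memvD // memvZ.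
(* A rational strictly between 0 and [b]: contracting by [1 - r / b] takes the coordinate [b] of [z]
   to [r]. *)
have [r [r0 r1]] : exists r : rat, 0 < ratr r / b /\ ratr r / b < 1.
  case/orP: (lt_total b0) => [bn|bp].
    have [r] := rat_in_itvoo bn; rewrite in_itv /= => /andP[rb rn].
    by exists r; move: (ratr r) rb rn => s *; rewrite ltr_ndivlMr // ltr_ndivrMr // mul0r mul1r.
  have [r] := rat_in_itvoo bp; rewrite in_itv /= => /andP[rn rb].
  by exists r; move: (ratr r) rb rn => s *; rewrite ltr_pdivlMr // ltr_pdivrMr // mul0r mul1r.
have d01 : 0 < 1 - ratr r / b <= 1 by rewrite subr_gt0 r1 lerBlDr lerDl ltW.
have [q [y Ky yE]] := contraction_rational_point a d01.
have := yE b; rewrite -ua -zE (addrC p) subrK => {}yE.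
have rb : (1 - (1 - ratr r / b)) * b = ratr r by field.
exists (q, r); split.
  rewrite /rational_point /= -rb -yE subKr.
  by apply: cD => //; [exact: KD|rewrite !ltW].
move=> /KV; rewrite /flat /rational_point /= addrC addKr => h.
have qX : \sum_i ratr (q i) *: X`_i \in <<X>>%VS.
  by apply: memv_suml => i _; rewrite memvZ // memv_span // mem_nth.
have := memvB h qX; rewrite addrC addKr => /(memvZ (ratr r)^-1).
rewrite scalerA mulVf ?scale1r; first exact/negP.
by apply: contraTneq r0 => ->; rewrite mul0r ltxx.
Qed.

End rational_points.

(** * Uncountable families meeting pairwise in [K] *)

(** Such an injection would make the real line countable, hence of Lebesgue measure zero. *)
Lemma no_injection_real_countType (R : realType) (T : countType) (f : R -> T) :
  ~ injective f.
Proof.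
move=> fi; have : countable [set: R].
  by apply/countable_injP; exists (pickle \o f) => x y _ _ /(pcan_inj pickleK)/fi.
move=> /countable_lebesgue_measure0.
have := @lebesgue_measure_itv R `]-oo, +oo[; rewrite /= set_itvE => -> //.
Qed.

(** Otherwise choosing a rational point of [F t] outside [K] for each [t] is injective: a point
    shared by [F s] and [F t] with [s != t] lies in [K]. *)
Lemma family_leaves_flat (R : realType) n (K : compactConvex R n) p v
    (X : seq 'rV[R]_n) (F : R -> compactConvex R n) :
  (K : set _) p -> (forall x, x \in X -> (K : set _) (p + x)) ->
  (K : set _) `<=` flat p <<X>>%VS ->
  (forall t, (K < F t)%O) -> (forall s t, s != t -> (F s `&` F t)%O = K) ->
  exists t, ~ (F t : set _) `<=` flat p (<<X>> + <[v]>)%VS.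
Proof.
move=> Kp KX KV KF FK; apply: contrapT => h.
have /choice[f hf] t : exists w, (F t : set _) (@rational_point R n p v X w) /\
    ~ (K : set _) (@rational_point R n p v X w).
  apply: rational_point_outside => //; first exact: ltW (KF t).
    by rewrite lt_geF.
  by apply: contrapT => ht; apply: h; exists t.
apply: (@no_injection_real_countType R _ f) => s t st.
apply/eqP; apply: contrapT => /negP /FK sKt.
have [_] := hf s; apply; rewrite -sKt; split; first exact: (hf s).1.
by rewrite st; exact: (hf t).1.
Qed.

(** * Points as generators of the lattice *)

Section points.
Context {R : realType} {n : nat}.
Implicit Types (C D : compactConvex R n) (x y z : 'rV[R]_n) (V : {vspace 'rV[R]_n}).

Fact convex_set0 : @convex_set R 'rV[R]_n set0.
Proof. by apply/convex_setP => x y t []. Qed.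

Fact convex_set1 x : @convex_set R 'rV[R]_n [set x].
Proof.
apply/convex_setP => _ _ t /= -> -> _.
by rewrite -scalerDl addrC subrK scale1r.
Qed.

Definition cc_empty : compactConvex R n := CompactConvex compact0 convex_set0.

Definition cc_point x : compactConvex R n :=
  CompactConvex (@compact_set1 _ x) (@convex_set1 x).

Lemma cc_empty_le C : (cc_empty <= C)%O.
Proof. exact/cc_leE. Qed.

Lemma cc_point_le x C : (cc_point x <= C)%O <-> (C : set _) x.
Proof.
split => [/cc_leE|Cx]; first exact.
by apply/cc_leE => _ ->.
Qed.

Lemma cc_point_meet x y : x != y -> (cc_point x `&` cc_point y)%O = cc_empty.
Proof.
move=> xy; apply: cc_inj; rewrite cc_meetE -subset0 => z [-> xy'].
by move: xy; rewrite xy' eqxx.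
Qed.

Lemma cc_convex_comb C x y t : (C : set _) x -> (C : set _) y -> 0 <= t <= 1 ->
  (C : set _) (t *: x + (1 - t) *: y).
Proof. exact: (convex_setP _).1 (cc_convex C) x y t. Qed.

Lemma cc_join_point C x z : (C : set _) !=set0 ->
  ((C `|` cc_point x)%O : set _) z <->
  exists t y, [/\ 0 <= t <= 1, (C : set _) y & z = t *: y + (1 - t) *: x].
Proof.
move=> C0; rewrite cc_joinE conv_hullUE //; last 3 first.
- exact: cc_convex.
- exact: cc_convex.
- by exists x.
split => [[[t [y _]] /= [] t01 [Cy ->] <-]|[t [y [t01 Cy ->]]]].
  by exists t, y; split.
by exists (t, (y, x)).
Qed.

(** An ideal with all points has members containing arbitrarily large cubes, built one coordinate at
    a time. Compact sets are bounded, so each lies below such a member. *)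
Lemma join_point_ideal_total (P : compactConvex R n -> Prop) :
  (forall x, P (cc_point x)) -> (forall C D, P C -> P D -> P (C `|` D)%O) ->
  (forall C D, (C <= D)%O -> P D -> P C) -> forall C, P C.
Proof.
move=> Ppt PU Ple.
have box k (N : R) : exists2 D, P D & forall x, (forall i, `|x 0 i| <= N) ->
    (forall i : 'I_n, (k <= i)%N -> x 0 i = 0) -> (D : set _) x.
  elim: k N => [|k IH] N.
    exists (cc_point 0) => // x _ x0 /=.
    by apply/rowP => i; rewrite x0 // mxE.
  have [kn|kn] := ltnP k n; last first.
    have [D PD hD] := IH N; exists D => // x xN xk; apply: hD => // i ki.
    by have := leq_trans (ltn_ord i) kn; rewrite ltnNge ki.
  (* The factor 2 serves the midpoint below: [x] is halfway between [2 *: (x - a *: e)], whose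
     coordinate [k] is zero, and [(2 * a) *: e]. *)
  have [D PD hD] := IH (2 * N).
  pose e : 'rV[R]_n := delta_mx 0 (Ordinal kn).
  exists (D `|` (cc_point ((2 * N) *: e) `|` cc_point (- (2 * N) *: e)))%O.
    by apply: (PU) => //; exact: PU.
  move=> x xN xk; set E : compactConvex R n := (X in cc_set X x).
  have ED : (D : set _) `<=` E by apply/cc_leE; exact: leUl.
  have E1 : (E : set _) ((2 * N) *: e).
    by apply/cc_point_le/lexUr/leUl.
  have E2 : (E : set _) (- (2 * N) *: e).
    by apply/cc_point_le/lexUr/leUr.
  set a := x 0 (Ordinal kn).
  have aN : `|a| <= N by exact: xN.
  have N0 : 0 <= N by exact: le_trans aN.
  have half01 : 0 <= (2^-1 : R) <= 1 by apply/andP; split; lra.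
  have Ea : (E : set _) ((2 * a) *: e).
    have [N00|N00] := eqVneq N 0.
      move: E1; rewrite N00; move: aN; rewrite N00 normr_le0 => /eqP ->.
      exact.
    have Np : 0 < N by rewrite lt_neqAle eq_sym N00.
    have := @cc_convex_comb E _ _ ((N + a) / (2 * N)) E1 E2.
    rewrite !scalerA -scalerDl; have -> : (N + a) / (2 * N) * (2 * N) +
      (1 - (N + a) / (2 * N)) * - (2 * N) = 2 * a by field.
    apply; move: aN; rewrite ler_norml => /andP[aN1 aN2].
    have N2 : 0 < 2 * N by rewrite mulr_gt0.
    by apply/andP; split; [rewrite divr_ge0 //; lra|rewrite ler_pdivrMr //; lra].
  have Dx : (D : set _) (2 *: (x - a *: e)).
    apply: hD => i.
      rewrite !mxE eqxx /= normrM (ger0_norm (ler0n _ _)) ler_pM2l //.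
      have [->|_] := eqVneq; first by rewrite mulr1 subrr normr0.
      by rewrite mulr0 subr0.
    rewrite leq_eqVlt => /orP[/eqP ki|ki].
      by rewrite !mxE eqxx /= (_ : i = Ordinal kn) ?eqxx ?mulr1 ?subrr ?mulr0 //; apply: val_inj.
    by rewrite !mxE xk // (_ : (i == _) = false) ?andbF ?mulr0 ?subrr ?mulr0 // -val_eqE /= gtn_eqF.
  have := cc_convex_comb (ED _ Dx) Ea half01.
  rewrite (_ : 2^-1 *: _ + _ = x) //.
  by apply/rowP => i; rewrite !mxE; field.
move=> C; have [M [_ hM]] := compact_bounded (cc_compact C).
have [D PD hD] := box n (`|M| + 1).
apply: Ple PD; apply/cc_leE => x Cx; apply: hD => i; last first.
  by rewrite leqNgt ltn_ord.
apply: le_trans (hM (`|M| + 1) _ _ Cx); last by rewrite (le_lt_trans (ler_norm M)) // ltrDl.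
rewrite [leRHS]mx_normrE.
exact: (@le_bigmax _ _ _ _ (fun ij : 'I_1 * 'I_n => `|x ij.1 ij.2|) (0, i)).
Qed.

End points.

(** * Strict monotonicity of non-trivial homomorphisms *)

Lemma lmorphism_lt (R : realType) (c d : nat)
    (Phi : {lmorphism compactConvex R c -> compactConvex R d}) :
  ~ trivial_morphism Phi -> {homo Phi : C D / (C < D)%O}.
Proof.
have PhiI A B : Phi (A `&` B)%O = (Phi A `&` Phi B)%O := omorphI Phi A B.
have PhiU A B : Phi (A `|` B)%O = (Phi A `|` Phi B)%O := omorphU Phi A B.
have Phile A B : (A <= B)%O -> (Phi A <= Phi B)%O by exact: omorph_le.
move=> hPhi C D CD; have CD' := ltW CD.
rewrite lt_neqAle Phile // andbT; apply/negP => /eqP PCD; apply: hPhi.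
have [x Dx Cx] : exists2 x, (D : set _) x & ~ (C : set _) x.
  apply: contrapT => h; move: CD; rewrite lt_neqAle => /andP[/eqP + _]; apply.
  apply/le_anti; rewrite CD' /=; apply/cc_leE => x Dx.
  by apply: contrapT => Cx; apply: h; exists x.
have Px : Phi (cc_point x) = Phi cc_empty.
  have <- : (cc_point x `&` D)%O = cc_point x by apply/meet_l/cc_point_le.
  have <- : (cc_point x `&` C)%O = cc_empty.
    by apply: cc_inj; rewrite cc_meetE -subset0 => _ [-> /Cx].
  by rewrite !PhiI PCD.
exists (Phi cc_empty); apply: join_point_ideal_total.
- move=> y; have [-> //|yx] := eqVneq y x.
  (* The reflection of [x] in [y], so [y] lies in the join of [x] and [z]. As [x] has the image of
     the empty set, the image of [y] lies below that of [z], yet their meet is the image of the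
     empty set. *)
  pose z := 2 *: y - x.
  have yz : y != z.
    apply: contra yx => /eqP yz; apply/eqP/rowP => i.
    by have /rowP/(_ i) := yz; rewrite !mxE; lra.
  rewrite -(cc_point_meet yz) PhiI; symmetry; apply: meet_l.
  have -> : Phi (cc_point z) = Phi (cc_point x `|` cc_point z)%O.
    by rewrite PhiU Px -PhiU join_r // cc_empty_le.
  apply: Phile; apply/cc_point_le/cc_join_point; first by exists x.
  exists 2^-1, x; split => //; first by apply/andP; split; lra.
    by apply/rowP => i; rewrite !mxE; field.
- by move=> A B PA PB; rewrite PhiU PA PB joinxx.
- move=> A B AB PB; apply/le_anti; rewrite -{1}PB !Phile //.
  exact: cc_empty_le.
Qed.

(** * Linear subspaces and pencils of points *)

Section flats.
Context {R : realType} {n : nat}.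
Implicit Types (V : {vspace 'rV[R]_n}) (u v : 'rV[R]_n).

Lemma dim_rowv : \dim (fullv : {vspace 'rV[R]_n}) = n.
Proof. by rewrite dimvf dim_matrix mul1r. Qed.

Lemma exists_notin_vspace V : (\dim V < n)%N -> exists u, u \notin V.
Proof.
move=> Vn; apply: contrapT => h; move: Vn; rewrite ltnNge -[X in (X <= _)%N]dim_rowv dimvS //.
apply/subvP => u _; apply: contrapT => /negP uV; by apply: h; exists u.
Qed.

Lemma dimv_add_line_le V v : (\dim (V + <[v]>) <= (\dim V).+1)%N.
Proof.
apply: leq_trans (dimv_add_leqif V _) _.
by rewrite dim_vline addnC; case: eqP.
Qed.

Lemma dimv_add_line V v : v \notin V -> \dim (V + <[v]>) = (\dim V).+1.
Proof.
move=> vV; apply/eqP; rewrite eqn_leq dimv_add_line_le ltn_neqAle dimvS ?addvSl // andbT.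
apply: contra vV => /eqP e.
have /eqP -> : (V == V + <[v]>)%VS by rewrite eqEdim addvSl e leqnn.
by apply: (subvP (addvSr _ _)); exact: memv_line.
Qed.

Lemma exists_line_complement V : (n <= (\dim V).+1)%N ->
  exists v, (V + <[v]>)%VS = fullv.
Proof.
move=> Vn; have [Vlt|Vge] := ltnP (\dim V) n.
  have [v vV] := exists_notin_vspace Vlt; exists v.
  by apply/eqP; rewrite eqEdim subvf dim_rowv dimv_add_line.
by exists 0; apply/eqP; rewrite eqEdim subvf dim_rowv (leq_trans Vge) // dimvS // addvSl.
Qed.

(* [x t = p + u + t v], where [p] is in [C] and [u], [v] are independent modulo
   the direction of [C]. *)
Lemma exists_point_pencil (C : compactConvex R n) : set_dim C <= n%:Z - 2 ->
  exists x : R -> 'rV[R]_n,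
    [/\ forall t, ~ (C : set _) (x t),
        forall s t, s != t ->
          ((C `|` cc_point (x s)) `&` (C `|` cc_point (x t)))%O = C &
        forall t, set_dim (C `|` cc_point (x t))%O <= set_dim C + 1].
Proof.
have [C0|/set0P[p Cp]] := eqVneq (C : set _) set0.
  (* For empty [C] distinct points on a line suffice: their pairwise meets are empty, and the
     dimension grows from -1 to 0. *)
  have -> : C = cc_empty by exact: cc_inj.
  rewrite set_dim0 => n1; have /exists_notin_vspace[v v0] : (\dim (0%VS : {vspace 'rV[R]_n}) < n)%N.
    by rewrite dimv0; lia.
  rewrite memv0 in v0; exists (fun t => t *: v); split => [t []|s t st|t].
    rewrite !join_r ?cc_empty_le //; apply: cc_point_meet.
    apply: contra st => /eqP /(congr1 (fun w => w - t *: v)).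
    by rewrite subrr -scalerBl => /eqP; rewrite scaler_eq0 (negbTE v0) orbF subr_eq0.
  rewrite join_r ?cc_empty_le //.
  have -> : -1 + 1 = (\dim (0%VS : {vspace 'rV[R]_n}))%:Z by rewrite dimv0 addNr.
  apply: (@set_dim_flat _ _ _ (t *: v)); last by exists (t *: v).
  by move=> _ ->; rewrite /flat /= subrr mem0v.
have [X [fX CX CV ->]] := set_dim_frame Cp; set V := <<X>>%VS in CV.
rewrite -(eqP fX) -/V => Vn.
have /exists_notin_vspace[u uV] : (\dim V < n)%N by lia.
have /exists_notin_vspace[v vV] : (\dim (V + <[u]>) < n)%N.
  by rewrite dimv_add_line //; move: (\dim V) Vn => k; lia.
have indep a b : a *: u + b *: v \in V -> a = 0 /\ b = 0.
  move=> abV; have b0 : b = 0.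
    apply: contraNeq vV => b0.
    have : b^-1 *: ((a *: u + b *: v) - a *: u) \in (V + <[u]>)%VS.
      rewrite memvZ // memvB //; first exact: (subvP (addvSl _ _)).
      by rewrite (subvP (addvSr _ _)) // memvZ // memv_line.
    by rewrite addrC addKr scalerA mulVf // scale1r.
  split=> //; move: abV; rewrite b0 scale0r addr0 => aV.
  apply: contraNeq uV => a0.
  by have := memvZ a^-1 aV; rewrite scalerA mulVf // scale1r.
pose x t := p + (u + t *: v).
have C0 : (C : set _) !=set0 by exists p.
exists x; split => [t /CV|s t st|t].
- rewrite /flat /x /= addrC addKr -[u in u + _]scale1r => /indep[/eqP].
  by rewrite oner_eq0.
- apply/le_anti/andP; split; last by rewrite lexI !leUl.
  apply/cc_leE => z [/(cc_join_point _ _ C0)[a [y [a01 Cy zy]]]].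
  move=> /(cc_join_point _ _ C0)[b [y' [b01 Cy' zy']]].
  (* Comparing the two representations of [z] modulo [V] gives [a = b] and [(1 - a) * (s - t) = 0],
     hence [a = 1] and [z = y]. *)
  have /indep[ab asbt] : ((1 - a) - (1 - b)) *: u + ((1 - a) * s - (1 - b) * t) *: v \in V.
    have -> : ((1 - a) - (1 - b)) *: u + ((1 - a) * s - (1 - b) * t) *: v =
        b *: (y' - p) - a *: (y - p).
      have /eqP := zy; rewrite zy' -subr_eq0 /x => /eqP e.
      rewrite -[LHS]addr0 -[X in _ + X = _]e; apply/rowP => i; rewrite !mxE; ring.
    by apply: memvB; apply: memvZ; exact: CV.
  have : (1 - a) * (s - t) = 0 by move: ab asbt; nra.
  move=> /eqP; rewrite mulf_eq0 (subr_eq0 s) (negbTE st) orbF subr_eq0 => /eqP a1.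
  by rewrite zy -a1 subrr scale0r addr0 scale1r.
- apply: (@le_trans _ _ (\dim (V + <[u + t *: v]>))%:Z); last first.
    by rewrite -PoszD lez_nat addn1 dimv_add_line_le.
  apply: (@set_dim_flat _ _ _ p); last by exists p; apply: (cc_leE _ _).1 Cp; exact: leUl.
  move=> z /(cc_join_point _ _ C0)[a [y [a01 Cy ->]]].
  have -> : a *: y + (1 - a) *: x t = p + (a *: (y - p) + (1 - a) *: (u + t *: v)).
    by apply/rowP => i; rewrite !mxE; ring.
  rewrite /flat /= addrC addKr memv_add ?memvZ ?memv_line //; exact: CV.
Qed.

End flats.

(** * Growth of the dimension of the image *)

(** The bound by [d - 2] is the base of the final induction, the set [D] its step. *)
Lemma lmorphism_dim_step (R : realType) (c d : nat)
    (Phi : {lmorphism compactConvex R c -> compactConvex R d}) :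
  ~ trivial_morphism Phi -> forall C : compactConvex R c,
  set_dim C <= c%:Z - 2 -> set_dim (Phi C) <= d%:Z - 2 /\
  exists2 D : compactConvex R c, set_dim D <= set_dim C + 1 &
    set_dim (Phi C) + 1 <= set_dim (Phi D).
Proof.
move=> hPhi C /exists_point_pencil[x [Cx xC dimx]].
pose F t := Phi (C `|` cc_point (x t))%O.
have CF t : (Phi C < F t)%O.
  apply: lmorphism_lt => //; rewrite lt_neqAle leUl andbT.
  apply/eqP => CE; apply: (Cx t); apply/cc_point_le; rewrite CE; exact: leUr.
have FC s t : s != t -> (F s `&` F t)%O = Phi C.
  by move=> st; rewrite -[in RHS](xC _ _ st); exact: esym (omorphI Phi _ _).
have [K0|/set0P[p Kp]] := eqVneq (Phi C : set _) set0.
  have F0 t : (F t : set _) !=set0.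
    apply/set0P/eqP => Ft0; have := CF t; rewrite lt_neqAle => /andP[/eqP + _].
    by apply; apply: cc_inj; rewrite K0 Ft0.
  rewrite K0 set_dim0; split; last first.
    by exists (C `|` cc_point (x 0))%O => //; rewrite addNr; apply: set_dim_ge0; exact: F0.
  suff : (0 < d)%N by lia.
  (* For [d = 0] there is only one point, so [F 0] and [F 1], both nonempty, would share it. *)
  rewrite lt0n; apply/eqP => d0; subst d.
  have [[y Fy] [z Fz]] := (F0 0, F0 1).
  suff : (Phi C : set _) y by rewrite K0.
  have /FC <- : 0 != 1 :> R by rewrite eq_sym oner_eq0.
  by split=> //; rewrite (thinmx0 y) -(thinmx0 z).
have [X [fX KX KV ->]] := set_dim_frame Kp.
split.
  (* If the dimension were at least [d - 1], a single [v] would extend the direction to the whole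
     space, which no [F t] can leave. *)
  rewrite leNgt; apply/negP => Xd.
  have [v vfull] : exists v, (<<X>> + <[v]>)%VS = fullv.
    by apply: exists_line_complement; rewrite (eqP fX); move: (size X) Xd => k; lia.
  have [t] := family_leaves_flat v Kp KX KV CF FC; apply.
  by move=> z _; rewrite /flat /= vfull memvf.
have [t Ft] := family_leaves_flat 0 Kp KX KV CF FC.
exists (C `|` cc_point (x t))%O => //; rewrite -/(F t).
have KF : (Phi C : set _) `<=` F t by apply/cc_leE/ltW.
(* Both frames start at [p], so it suffices to compare spans; equal dimensions would force [F t]
   back into the flat of [Phi C]. *)
have [Y [fY FY FV ->]] := set_dim_frame (KF _ Kp).
have XY : (<<X>> <= <<Y>>)%VS.
  by apply/span_subvP => w /KX /KF /FV; rewrite /flat /= addrC addKr.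
suff : (\dim <<X>> < \dim <<Y>>)%N by rewrite (eqP fX) (eqP fY) -PoszD lez_nat addn1.
rewrite ltn_neqAle dimvS // andbT; apply/eqP => XYd; apply: Ft => z /FV.
have /eqP -> : (<<X>> == <<Y>>)%VS by rewrite eqEdim XY XYd leqnn.
by rewrite /flat /=; apply: (subvP (addvSl _ _)).
Qed.

Theorem lemma3p8 (R : realType) (c d : nat) (hc : (2 <= c)%N)
    (Phi : {lmorphism compactConvex R c -> compactConvex R d})
    (hPhi : ~ trivial_morphism Phi) (C : compactConvex R c) :
  set_dim C <= c%:Z - 2 -> set_dim (Phi C) <= set_dim C + d%:Z - c%:Z.
Proof.
(* Here [j] is at most the gap between the dimension of [D] and [c - 2]. Each step lowers [j] by one
   and raises the dimension by at most one in the source and at least one in the image. *)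
have key j : forall D : compactConvex R c, set_dim D + j%:Z <= c%:Z - 2 ->
    set_dim (Phi D) + j%:Z <= d%:Z - 2.
  elim: j => [|j IH] D Dj.
    by move: Dj; rewrite !addr0 => /(lmorphism_dim_step hPhi)[].
  have Dc : set_dim D <= c%:Z - 2 by lia.
  have [_ [E DE PDE]] := lmorphism_dim_step hPhi Dc.
  by have := IH E; lia.
(* The claim is the case where [j] is the whole gap, nonnegative by [Cc]. *)
move=> Cc; have := key (absz (c%:Z - 2 - set_dim C)%R) C.
by rewrite gez0_abs ?subr_ge0 //; lia.
Qed.
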